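(* Let $\mathbb U$ and $\mathbb V$ be Banach spaces and let $B:\mathbb U\to\mathbb V^*$ be a linear operator with $\gamma_B\|w\|_{\mathbb U}\le\|Bw\|_{\mathbb V^*}\le M_B\|w\|_{\mathbb U}$ for all $w\in\mathbb U$, where $M_B>0$ and $\gamma_B>0$. Assume that $\mathbb V$ and $\mathbb V^*$ are reflexive and strictly convex. Let $\mathbb U_n\subset\mathbb U$ and $\mathbb V_m\subset\mathbb V$ be finite-dimensional subspaces such that the Fortin condition holds: there exist an operator $\Pi:\mathbb V\to\mathbb V_m$ and constants $C_\Pi>0$, $D_\Pi>0$ such that $\|\Pi v\|_{\mathbb V}\le C_\Pi\|v\|_{\mathbb V}$ and $\|v-\Pi v\|_{\mathbb V}\le D_\Pi\|v\|_{\mathbb V}$ for all $v\in\mathbb V$, and $\langle Bw_n,v-\Pi v\rangle_{\mathbb V^*,\mathbb V}=0$ for all $w_n\in\mathbb U_n$ and $v\in\mathbb V$. Given $f=Bu\in\mathbb V^*$ with $u\in\mathbb U$, let $(r_m,u_n)\in\mathbb V_m\times\mathbb U_n$ be the unique solution of $$\langle J_{\mathbb V}(r_m),v_m\rangle_{\mathbb V^*,\mathbb V}+\langle Bu_n,v_m\rangle_{\mathbb V^*,\mathbb V}=\langle f,v_m\rangle_{\mathbb V^*,\mathbb V}\quad\forall v_m\in\mathbb V_m,\qquad\langle Bw_n,r_m\rangle_{\mathbb V^*,\mathbb V}=0\quad\forall w_n\in\mathbb U_n .$$ Then $$\|u-u_n\|_{\mathbb U}\le\frac1{\gamma_B}\,\mathrm{osc}(f)+\frac{C_\Pi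 M_B}{\gamma_B}\inf_{w_n\in\mathbb U_n}\|u-w_n\|_{\mathbb U}\le\frac{(D_\Pi+C_\Pi)M_B}{\gamma_B}\inf_{w_n\in\mathbb U_n}\|u-w_n\|_{\mathbb U},$$ where $\mathrm{osc}(f):=\sup_{v\in\mathbb V\setminus\{0\}}\langle f,v-\Pi v\rangle_{\mathbb V^*,\mathbb V}/\|v\|_{\mathbb V}$.
   Context: All spaces are real. For a normed space $\mathbb Y$, the duality mapping is $\mathcal J_{\mathbb Y}(y)=\{y^*\in\mathbb Y^*:\langle y^*,y\rangle=\|y\|_{\mathbb Y}^2=\|y^*\|_{\mathbb Y^*}^2\}$. A normed space is strictly convex if $\|\theta y_1+(1-\theta)y_2\|<1$ whenever $y_1\ne y_2$, $\|y_1\|=\|y_2\|=1$, $\theta\in(0,1)$. If $\mathbb Y$ and $\mathbb Y^*$ are strictly convex and reflexive Banach spaces, then $\mathcal J_{\mathbb Y}(y)=\{J_{\mathbb Y}(y)\}$ is single-valued and $J_{\mathbb Y}:\mathbb Y\to\mathbb Y^*$ is a bijection (known fact). Under the stated hypotheses the discrete mixed problem has a unique solution. *)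

(* Defs.v *)
From HB Require Import structures.
From mathcomp Require Import all_boot all_order all_algebra.
From mathcomp Require Import all_classical all_reals all_analysis.

Set Implicit Arguments.
Unset Strict Implicit.
Unset Printing Implicit Defensive.

Import Order.TTheory GRing.Theory Num.Theory.
Import numFieldNormedType.Exports.

Local Open Scope classical_set_scope.
Local Open Scope ring_scope.

Section Dual.
Context {R : realType} {V : normedModType R}.

Definition dual_pred : {pred V -> R^o} :=
  fun f => `[< linear f /\ continuous f >].

Lemma dual_pred_submod : submod_closed dual_pred.
Proof.
split.
  apply/asboolP; split; last by move=> x; exact: cst_continuous.
  by move=> a x y; rewrite /= /GRing.zero /= scaler0 addr0.
move=> a f g /asboolP[lf cf] /asboolP[lg cg]; apply/asboolP; split.
  move=> b x y; change (a *: f (b *: x + y) + g (b *: x + y) =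
    b *: (a *: f x + g x) + (a *: f y + g y)).
  rewrite lf lg !scalerDr !scalerA (mulrC b a) -!addrA; congr (_ + _).
  by rewrite addrCA.
move=> x; apply: (@continuousD R R^o V (a *: f) g x); last exact: cg.
by apply: continuousZl_tmp; exact: cf.
Qed.

HB.instance Definition _ :=
  GRing.isSubmodClosed.Build R (V -> R^o) dual_pred dual_pred_submod.

End Dual.
Arguments dual_pred {R} V.

Record dual (R : realType) (V : normedModType R) : Type :=
  Dual { dual_fun :> V -> R^o ; dual_funP : dual_fun \in dual_pred V }.

Section DualNormedModule.
Context {R : realType} {V : normedModType R}.

HB.instance Definition _ := [isSub for @dual_fun R V].
HB.instance Definition _ := [Choice of dual V by <:].
HB.instance Definition _ := [SubChoice_isSubLmodule of dual V by <:].

Lemma dual_linear (f : dual V) : linear f.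
Proof. by have /asboolP[] := dual_funP f. Qed.

HB.instance Definition _ (f : dual V) :=
  GRing.isLinear.Build R V R^o *:%R f (dual_linear f).

Lemma dual_continuous (f : dual V) : continuous f.
Proof. by have /asboolP[] := dual_funP f. Qed.

Lemma dualP (f g : dual V) : (forall v, f v = g v) -> f = g.
Proof. by move=> fg; apply: val_inj; exact/funext. Qed.

Lemma dualDE (f g : dual V) v : (f + g) v = f v + g v. Proof. by []. Qed.
Lemma dualZE a (f : dual V) v : (a *: f) v = a * f v. Proof. by []. Qed.
Lemma dual0E v : (0 : dual V) v = 0. Proof. by []. Qed.

Definition dual_norm (f : dual V) : R :=
  sup [set `|f v| | v in [set v : V | `|v| <= 1]].

Lemma dual_norm_has_sup (f : dual V) :
  has_sup [set `|f v| | v in [set v : V | `|v| <= 1]].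
Proof.
split; first by exists `|f 0|, 0 => //=; rewrite normr0.
have /linear_bounded_continuous/linear_boundedP fb := @dual_continuous f.
have [r r0 fr] := pinfty_ex_gt0 fb.
exists r => _ [v /= v1 <-]; rewrite (le_trans (fr v))//.
by rewrite -[leRHS]mulr1 ler_wpM2l// ltW.
Qed.

Lemma dual_normP (f : dual V) v : `|f v| <= dual_norm f * `|v|.
Proof.
have [->|v0] := eqVneq v 0; first by rewrite linear0 !normr0 mulr0.
have nv0 : 0 < `|v| by rewrite normr_gt0.
rewrite -ler_pdivrMr//.
have -> : `|f v| / `|v| = `|f (`|v|^-1 *: v)|.
  by rewrite linearZ /= normrM normfV normr_id mulrC.
apply: (sup_upper_bound (dual_norm_has_sup f)).
exists (`|v|^-1 *: v) => //=.
by rewrite normrZ normfV normr_id mulVf// gt_eqF.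
Qed.

Lemma dual_norm_le (f : dual V) (c : R) :
  (forall v, `|v| <= 1 -> `|f v| <= c) -> dual_norm f <= c.
Proof.
move=> fc; apply: ge_sup; first by case: (dual_norm_has_sup f).
by move=> _ [v /= v1 <-]; exact: fc.
Qed.

Lemma dual_norm_ge0 (f : dual V) : 0 <= dual_norm f.
Proof.
apply: (sup_upper_bound (dual_norm_has_sup f)).
by exists 0 => /=; rewrite ?linear0 normr0.
Qed.

Lemma dual_normD (f g : dual V) : dual_norm (f + g) <= dual_norm f + dual_norm g.
Proof.
apply: dual_norm_le => v v1; rewrite dualDE (le_trans (ler_normD _ _))//.
by apply: lerD; rewrite (le_trans (dual_normP _ _))// -[leRHS]mulr1
  ler_wpM2l// dual_norm_ge0.
Qed.

Lemma dual_normZ (a : R) (f : dual V) : dual_norm (a *: f) = `|a| * dual_norm f.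
Proof.
have le b (g : dual V) : dual_norm (b *: g) <= `|b| * dual_norm g.
  apply: dual_norm_le => v v1; rewrite dualZE normrM ler_wpM2l//.
  by rewrite (le_trans (dual_normP _ _))// -[leRHS]mulr1 ler_wpM2l// dual_norm_ge0.
apply/eqP; rewrite eq_le le /=.
have [->|a0] := eqVneq a 0; first by rewrite normr0 mul0r dual_norm_ge0.
rewrite -ler_pdivlMl ?normr_gt0// -normfV.
by rewrite -{1}[f](scalerK a0) le.
Qed.

Lemma dual_norm0_eq0 (f : dual V) : dual_norm f = 0 -> f = 0.
Proof.
move=> f0; apply: dualP => v; apply/eqP; rewrite -normr_le0.
by rewrite (le_trans (dual_normP f v))// f0 mul0r.
Qed.

HB.instance Definition _ :=
  Lmodule_isNormed.Build R (dual V) dual_normD dual_normZ dual_norm0_eq0.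

End DualNormedModule.

Section Notions.
Context {R : realType}.

Definition strictly_convex (Y : normedModType R) : Prop :=
  forall (y1 y2 : Y) (t : R), y1 != y2 -> `|y1| = 1 -> `|y2| = 1 ->
    0 < t < 1 -> `|t *: y1 + (1 - t) *: y2| < 1.

(* Surjectivity of the canonical embedding of Y into its bidual. *)
Definition reflexive_space (Y : normedModType R) : Prop :=
  forall phi : dual (dual Y), exists y : Y, forall g : dual Y, phi g = g y.

Definition duality_mapping (Y : normedModType R) (y : Y) : set (dual Y) :=
  [set g : dual Y | g y = `|y| ^+ 2 /\ `|y| ^+ 2 = `|g| ^+ 2].

(* The element of [duality_mapping y], which is a singleton when Y and its
   dual are reflexive and strictly convex; the default value 0 is used only
   if the set is empty. *)
Definition J (Y : normedModType R) (y : Y) : dual Y :=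
  xget 0 (duality_mapping y).

Definition finite_dim_subspace (Y : normedModType R) (W : set Y) : Prop :=
  submod_closed (mem W) /\
  exists (n : nat) (e : 'I_n -> Y), (forall i, W (e i)) /\
    forall w, W w -> exists a : 'I_n -> R, w = \sum_(i < n) a i *: e i.

(* When Y = 0 the supremum is over the empty set and equals 0. *)
Definition osc (Y : normedModType R) (Pi : Y -> Y) (f : dual Y) : R :=
  sup [set f (v - Pi v) / `|v| | v in [set v : Y | v != 0]].

End Notions.

(* Main.v *)
(* Put g = f - B u_n. Splitting v = (v - Pi v) + Pi v and using Fortin
   orthogonality, g v = <f, v - Pi v> + <J r_m, Pi v>, so that
   |g| <= osc f + C_Pi |J r_m|; testing the first equation with r_m gives
   |r_m|^2 = <f - B w_n, r_m> for every w_n, whence |J r_m| <= M_B |u - w_n|.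
   Existence of a duality element is never needed: where the duality mapping
   is empty, J takes the junk value 0, for which these bounds still hold. *)
Require Import Defs.
From HB Require Import structures.
From mathcomp Require Import all_boot all_order all_algebra.
From mathcomp Require Import all_classical all_reals all_analysis.
From mathcomp Require Import ring lra.

Import Order.TTheory GRing.Theory Num.Theory.
Import numFieldNormedType.Exports.

Local Open Scope classical_set_scope.
Local Open Scope ring_scope.

Section DualityBounds.
Context {R : realType} {V : normedModType R}.
Implicit Types (f g : dual V) (c : R).

Lemma dualBE f g v : (f - g) v = f v - g v.
Proof. by []. Qed.

Lemma dual_le_norm f v : f v <= `|f| * `|v|.
Proof. exact: le_trans (ler_norm _) (dual_normP f v). Qed.

(** A one-sided bound suffices: applied at [- v] it also bounds [- g v]. *)
Lemma dual_norm_le_upper g c :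
  0 <= c -> (forall v, g v <= c * `|v|) -> `|g| <= c.
Proof.
move=> c0 gc; apply: dual_norm_le => v v1.
apply: (@le_trans _ _ (c * `|v|)); last by rewrite ler_piMr.
rewrite ler_norml gc andbT lerNl.
by have := gc (- v); rewrite linearN normrN.
Qed.

(** A duality element [g] of [y] has [g y] equal to the square of [|y|] and norm [|y|], so a factor
    [|y|] cancels unless [y = 0]. *)
Lemma J_norm_le (y : V) c : 0 <= c -> J y y <= c * `|y| -> `|J y| <= c.
Proof.
move=> c0; rewrite /J; case: xgetP => [g _ [gy nyg]|_]; last by rewrite normr0.
have <- : `|y| = `|g| by apply/eqP; rewrite -(@eqrXn2 _ 2) ?nyg.
rewrite gy expr2; have [->|y0] := eqVneq y 0; first by rewrite !normr0.
by rewrite ler_pM2r ?normr_gt0.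
Qed.

Lemma osc_le (P : V -> V) f c :
  0 <= c -> (forall v, f (v - P v) <= c * `|v|) -> osc P f <= c.
Proof.
move=> c0 fc; rewrite /osc; set S := (X in sup X).
have [->|S0] := eqVneq S set0; first by rewrite sup0.
apply: ge_sup; first exact/set0P.
by move=> _ [v /= v0 <-]; rewrite ler_pdivrMr ?normr_gt0.
Qed.

(** The constant [c] only shows that the set of quotients is bounded above, so that [sup] is a
    genuine upper bound. *)
Lemma osc_ub (P : V -> V) f c v :
  (forall v, f (v - P v) <= c * `|v|) -> v != 0 ->
  f (v - P v) <= osc P f * `|v|.
Proof.
move=> fc v0; rewrite -ler_pdivrMr ?normr_gt0//.
apply: ub_le_sup; last by exists v.
by exists c => _ [w /= w0 <-]; rewrite ler_pdivrMr ?normr_gt0.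
Qed.

Lemma osc_trivial (P : V -> V) f : (forall v : V, v = 0) -> osc P f = 0.
Proof.
move=> V0; rewrite /osc (_ : [set _ | _ in _] = set0) ?sup0//.
by apply/seteqP; split=> // _ [v /= /eqP[]]; rewrite (V0 v).
Qed.

End DualityBounds.

Theorem corollary4p4 (R : realType) (U V : completeNormedModType R)
  (B : {linear U -> dual V}) (gammaB MB : R)
  (gammaB_gt0 : 0 < gammaB) (MB_gt0 : 0 < MB)
  (B_bounds : forall w : U, gammaB * `|w| <= `|B w| <= MB * `|w|)
  (V_reflexive : reflexive_space V)
  (Vdual_reflexive : reflexive_space (dual V))
  (V_strictly_convex : strictly_convex V)
  (Vdual_strictly_convex : strictly_convex (dual V))
  (Un : set U) (Vm : set V)
  (Un_fin : finite_dim_subspace Un) (Vm_fin : finite_dim_subspace Vm)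
  (Pi : V -> V) (CPi DPi : R)
  (CPi_gt0 : 0 < CPi) (DPi_gt0 : 0 < DPi)
  (Pi_Vm : forall v : V, Vm (Pi v))
  (Pi_bound : forall v : V, `|Pi v| <= CPi * `|v|)
  (Pi_approx : forall v : V, `|v - Pi v| <= DPi * `|v|)
  (Pi_orth : forall (wn : U) (v : V), Un wn -> B wn (v - Pi v) = 0)
  (u : U) (f : dual V) (f_def : f = B u)
  (rm : V) (un : U) (rm_Vm : Vm rm) (un_Un : Un un)
  (eq1 : forall vm : V, Vm vm -> J rm vm + B un vm = f vm)
  (eq2 : forall wn : U, Un wn -> B wn rm = 0) :
  `|u - un| <= gammaB^-1 * osc Pi f
               + CPi * MB / gammaB * inf [set `|u - wn| | wn in Un]
  /\
  gammaB^-1 * osc Pi f + CPi * MB / gammaB * inf [set `|u - wn| | wn in Un]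
    <= (DPi + CPi) * MB / gammaB * inf [set `|u - wn| | wn in Un].
Proof.
set d := inf _; pose g := f - B un.
have dist_n0 : [set `|u - wn| | wn in Un] !=set0 by exists `|u - un|, un.
have d_ge0 : 0 <= d by apply: lb_le_inf => // _ [w _ <-].
have resid_norm w : `|f - B w| <= MB * `|u - w|.
  by rewrite f_def -linearB; have /andP[] := B_bounds (u - w).
(* Passage to the infimum, used for both [|J rm|] and [osc]. *)
have le_MBd x : (forall w, Un w -> x <= MB * `|u - w|) -> x <= MB * d.
  move=> xw; rewrite -ler_pdivrMl//; apply: lb_le_inf => // _ [w Uw <-].
  by rewrite ler_pdivrMl// xw.
have Jrm_le : `|J rm| <= MB * d.
  apply: le_MBd => w Uw; apply: J_norm_le; first by rewrite mulr_ge0// ltW.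
  have -> : J rm rm = (f - B w) rm.
    by have := eq1 rm rm_Vm; rewrite eq2// addr0 dualBE => ->; rewrite eq2// subr0.
  by rewrite (le_trans (dual_le_norm _ _))// ler_wpM2r.
(* Orthogonality allows any [B w] to be subtracted from [f]. The choice [w = un] makes [osc] finite;
   letting [w] vary gives the second estimate. *)
have osc_bound v w : Un w -> f (v - Pi v) <= MB * `|u - w| * DPi * `|v|.
  move=> Uw; have -> : f (v - Pi v) = (f - B w) (v - Pi v).
    by rewrite dualBE Pi_orth// subr0.
  rewrite (le_trans (dual_le_norm _ _))// -[leRHS]mulrA.
  by rewrite ler_pM.
have oscE v : v != 0 -> f (v - Pi v) <= osc Pi f * `|v|.
  by apply: osc_ub => v'; exact: (osc_bound v' un).
have gE v : g v = f (v - Pi v) + J rm (Pi v).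
  have <- : g (v - Pi v) = f (v - Pi v).
    by rewrite dualBE Pi_orth// subr0.
  (* First equation tested with [Pi v], which lies in [Vm]. *)
  have -> : J rm (Pi v) = g (Pi v).
    by rewrite dualBE -eq1// addrK.
  by rewrite -linearD subrK.
set c := osc Pi f + CPi * (MB * d).
have gc v : g v <= c * `|v|.
  have [->|v0] := eqVneq v 0; first by rewrite linear0 normr0 mulr0.
  rewrite gE mulrDl lerD ?oscE// (le_trans (dual_le_norm _ _))//.
  by rewrite [CPi * _]mulrC -mulrA ler_pM.
(* The sign of [osc] is not evident, as [Pi] need not be odd. Instead the bounds on [g v] and
   [g (- v)] add up to [0 <= 2 c |v|]; if [V = 0], then [osc] is a supremum over the empty set,
   hence 0. *)
have c_ge0 : 0 <= c.
  have [[v v0]|V0] := pselect (exists v : V, v != 0).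
    rewrite -(@pmulr_lge0 _ `|v|) ?normr_gt0//.
    have := gc v; have := gc (- v); rewrite normrN linearN => cN cP.
    by have := lerD cN cP; rewrite addNr; lra.
  rewrite /c osc_trivial ?add0r ?mulr_ge0 ?(ltW CPi_gt0) ?(ltW MB_gt0)// => v.
  by apply/eqP/negPn/negP => v0; apply: V0; exists v.
split.
  have -> : gammaB^-1 * osc Pi f + CPi * MB / gammaB * d = gammaB^-1 * c.
    by rewrite /c; ring.
  rewrite ler_pdivlMl//.
  (* Here [B (u - un) = g], so the lower bound on [B] turns the residual estimate into an error
     estimate. *)
  have /andP[+ _] := B_bounds (u - un).
  move/le_trans; apply; rewrite linearB -f_def.
  exact: dual_norm_le_upper.
have osc_d : osc Pi f <= DPi * (MB * d).
  (* [le_MBd] is applied to [osc] divided by [DPi]. *)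
  rewrite -ler_pdivrMl//; apply: le_MBd => w Uw; rewrite ler_pdivrMl//.
  rewrite mulrC; apply: osc_le => [|v]; last exact: osc_bound.
  by rewrite !mulr_ge0 ?(ltW DPi_gt0) ?(ltW MB_gt0).
have -> : (DPi + CPi) * MB / gammaB * d
    = gammaB^-1 * (DPi * (MB * d)) + CPi * MB / gammaB * d by ring.
by rewrite lerD2r ler_pM2l ?invr_gt0.
Qed.
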